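(* Let $\mathcal W$ be a measure matrix, $R(x)=\prod_{i=1}^d(x-r_i)^{m_i}$ with distinct $r_i\in\mathbb R$, $m_i\geq 1$, of degree $M=\sum_im_i$, and assume that $G_{\mathcal W}$, $\hat G_L=R(\Lambda)G_{\mathcal W}$ and $\hat G_R=G_{\mathcal W}R(\Lambda)^\top$ are $LU$-factorizable. Then for every $n\ge0$ the Christoffel transformed polynomials and norms are $$(\hat P_{1L})_n(x)=\frac1{R(x)}\Theta_*\left[\begin{array}{c|c}\Pi_r\begin{bmatrix}(P_1)_n\\ \vdots\\ (P_1)_{n+M-1}\end{bmatrix}&\begin{matrix}(P_1)_n(x)\\ \vdots\\ (P_1)_{n+M-1}(x)\end{matrix}\\ \hline \Pi_r[(P_1)_{n+M}]&(P_1)_{n+M}(x)\end{array}\right],\qquad \frac{(\hat P_{2L})_n(x)}{(\hat h_L)_n}=\Theta_*\left[\begin{array}{c|c}\Pi_r\begin{bmatrix}(P_1)_{n+1}\\ \vdots\\ (P_1)_{n+M}\end{bmatrix}&\begin{matrix}0\\ \vdots\\ 1\end{matrix}\\ \hline \Pi_r[K^{[n+1]}(x,\cdot)]&0\end{array}\right],$$ $$\frac{(\hat h_L)_n}{h_n}=\Theta_*\left[\begin{array}{c|c}\Pi_r\begin{bmatrix}(P_1)_n\\ (P_1)_{n+1}\\ \vdots\\ (P_1)_{n+M-1}\end{bmatrix}&\begin{matrix}1\\0\\ \vdots\\ 0\end{matrix}\\ \hline \Pi_r[(P_1)_{n+M}]&0\end{array}\right],$$ and $$(\hat P_{2R})_n(x)=\frac1{R(x)}\Theta_*\left[\begin{array}{c|c}\Pi_r\begin{bmatrix}(P_2)_n\\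 \vdots\\ (P_2)_{n+M-1}\end{bmatrix}&\begin{matrix}(P_2)_n(x)\\ \vdots\\ (P_2)_{n+M-1}(x)\end{matrix}\\ \hline \Pi_r[(P_2)_{n+M}]&(P_2)_{n+M}(x)\end{array}\right],\qquad \frac{(\hat P_{1R})_n(x)}{(\hat h_R)_n}=\Theta_*\left[\begin{array}{c|c}\Pi_r\begin{bmatrix}(P_2)_{n+1}\\ \vdots\\ (P_2)_{n+M}\end{bmatrix}&\begin{matrix}0\\ \vdots\\ 1\end{matrix}\\ \hline \Pi_r[K^{[n+1]}(\cdot,x)]&0\end{array}\right],$$ $$\frac{(\hat h_R)_n}{h_n}=\Theta_*\left[\begin{array}{c|c}\Pi_r\begin{bmatrix}(P_2)_n\\ (P_2)_{n+1}\\ \vdots\\ (P_2)_{n+M-1}\end{bmatrix}&\begin{matrix}1\\0\\ \vdots\\ 0\end{matrix}\\ \hline \Pi_r[(P_2)_{n+M}]&0\end{array}\right].$$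
   Context: Semi-infinite matrices and vectors are indexed from $0$; $A^{[k]}$ is the leading $k\times k$ truncation. A measure matrix of order $\mathcal N$ is a semi-infinite matrix $\mathcal W=(d\mu_{i,j})$ of (possibly signed) Borel measures on sets $\Omega_{i,j}\subseteq\mathbb R$, zero if $i>\mathcal N$ or $j>\mathcal N$; $(f,h;\mathcal W)=\sum_{n,r}\int_{\Omega_{n,r}}f^{(n)}h^{(r)}d\mu_{n,r}$ (finite on polynomials); $(G_{\mathcal W})_{n,p}=(x^n,x^p;\mathcal W)$. A matrix $G$ is $LU$-factorizable if $\det G^{[k]}\neq0$ for all $k\ge1$; then uniquely $G=S_1^{-1}H(S_2^{-1})^\top$ with $S_1,S_2$ lower unitriangular, $H=\mathrm{diag}(h_0,h_1,\dots)$; the monic polynomial sequences are $P_\alpha(x)=S_\alpha\chi(x)$, $\chi(x)=(1,x,x^2,\dots)^\top$, with $n$-th entry $(P_\alpha)_n$; $K^{[l]}(x,y)=\sum_{k=0}^{l-1}(P_2)_k(x)h_k^{-1}(P_1)_k(y)$. $\Lambda_{i,j}=\delta_{i+1,j}$. $\hat G_L=R(\Lambda)G_{\mathcal W}$ and $\hat G_R=G_{\mathcal W}R(\Lambda)^\top$ are the moment matrices of the forms $(Rf,h;\mathcal W)$ and $(f,Rh;\mathcal W)$; their polynomials and diagonal entries are denoted $\hat P_{1L},\hat P_{2L},\hat h_L$ and $\hat P_{1R},\hat P_{2R},\hat h_R$. Vector of germs: $\Pi_r[f]:=\big(\tfrac{f(r_1)}{0!},\tfrac{f'(r_1)}{1!},\dots,\tfrac{f^{(m_1-1)}(r_1)}{(m_1-1)!};\dots;\tfrac{f(r_d)}{0!},\dots,\tfrac{f^{(m_d-1)}(r_d)}{(m_d-1)!}\big)\in\mathbb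 R^{M}$; applied to a column of functions it gives the matrix whose rows are the germs of the entries; a dot marks the variable on which $\Pi_r$ acts. $\Theta_*\left[\begin{array}{c|c}A&B\\ \hline C&D\end{array}\right]:=D-CA^{-1}B$. *)

(* Defs.v *)
From HB Require Import structures.
From mathcomp Require Import all_boot all_order all_algebra.
From mathcomp Require Import all_classical all_reals all_analysis.

Set Implicit Arguments.
Unset Strict Implicit.
Unset Printing Implicit Defensive.

Import Order.TTheory GRing.Theory Num.Theory.

Local Open Scope classical_set_scope.
Local Open Scope ring_scope.

Section SemiInfinite.
Variable R : realType.

Definition smx := nat -> nat -> R.

Definition smx1 : smx := fun i j => (i == j)%:R.

Definition smx_diag (h : nat -> R) : smx := fun i j => h i *+ (i == j).

Definition smx_tr (A : smx) : smx := fun i j => A j i.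

(* The sum ranges over the k with a nonzero summand; it is 0 by convention if
   there are infinitely many.  Below, every product has a row-finite left factor
   or a column-finite right factor, so that the sum is a genuine finite sum. *)
Definition smx_mul (A B : smx) : smx :=
  fun i j => \sum_(k \in [set: nat]) (A i k * B k j).

Definition smx_shift : smx := fun i j => (i.+1 == j)%:R.

Definition smx_exp (A : smx) (k : nat) : smx := iter k (smx_mul A) smx1.

Definition smx_horner (p : {poly R}) (A : smx) : smx :=
  fun i j => \sum_(k < size p) p`_k * smx_exp A k i j.

Definition smx_trunc (A : smx) (k : nat) : 'M[R]_k := \matrix_(i, j) A i j.

Definition lower_unitriangular (S : smx) : Prop :=
  (forall i, S i i = 1) /\ (forall i j, (i < j)%N -> S i j = 0).

Definition smx_inverse (S T : smx) : Prop :=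
  smx_mul S T = smx1 /\ smx_mul T S = smx1.

Definition LU_factorizable (G : smx) : Prop :=
  forall k, (0 < k)%N -> \det (smx_trunc G k) != 0.

(* G = S1^-1 H (S2^-1)^T, with T1 = S1^-1 and T2 = S2^-1. *)
Definition is_LU (G : smx) (F : smx * smx * (nat -> R)) : Prop :=
  let: (S1, S2, h) := F in
  [/\ lower_unitriangular S1, lower_unitriangular S2 &
      exists T1 T2, [/\ smx_inverse S1 T1, smx_inverse S2 T2 &
        G = smx_mul (smx_mul T1 (smx_diag h)) (smx_tr T2)]].

(* The factorization exists and is unique when LU_factorizable G; the default
   value is irrelevant in that case. *)
Definition LU (G : smx) : smx * smx * (nat -> R) :=
  xget (smx1, smx1, fun=> 0) [set F | is_LU G F].

Definition LU_S1 (G : smx) : smx := (LU G).1.1.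
Definition LU_S2 (G : smx) : smx := (LU G).1.2.
Definition LU_h (G : smx) : nat -> R := (LU G).2.

(* The n-th entry of S chi(x), chi(x) = (1, x, x^2, ...)^T, for S lower
   triangular: the entries S n k with k > n vanish. *)
Definition smx_poly (S : smx) (n : nat) : {poly R} := \poly_(k < n.+1) S n k.

Definition P1 (G : smx) (n : nat) : {poly R} := smx_poly (LU_S1 G) n.
Definition P2 (G : smx) (n : nat) : {poly R} := smx_poly (LU_S2 G) n.

Definition CD_kernel (G : smx) (l : nat) (x y : R) : R :=
  \sum_(k < l) (P2 G k).[x] * (LU_h G k)^-1 * (P1 G k).[y].

End SemiInfinite.

Section ChargeIntegral.
Context {d : measure_display} {T : measurableType d} {R : realType}.
Variable nu : {charge set T -> \bar R}.

Lemma hahn_exists : exists PN, hahn_decomposition nu PN.1 PN.2.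
Proof. by have [P [N PN]] := Hahn_decomposition nu; exists (P, N). Qed.

(* The Jordan decomposition does not depend on the Hahn decomposition chosen. *)
Definition hahnP := svalP (cid hahn_exists).

Definition charge_integrable (D : set T) (f : T -> R) : Prop :=
  (jordan_pos hahnP).-integrable D (EFin \o f) /\
  (jordan_neg hahnP).-integrable D (EFin \o f).

Definition charge_integral (D : set T) (f : T -> R) : R :=
  \int[jordan_pos hahnP]_(x in D) f x - \int[jordan_neg hahnP]_(x in D) f x.

End ChargeIntegral.

(* A signed measure for which the constant 1 has a finite integral is finite,
   so that the (finite-valued) charges of the library lose no generality. *)
Record measure_matrix (R : realType) := MeasureMatrix {
  mm_order : nat;
  mm_supp : nat -> nat -> set (measurableTypeR R);
  mm_charge : nat -> nat -> {charge set (measurableTypeR R) -> \bar R};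
  mm_supp_measurable : forall i j, measurable (mm_supp i j);
  mm_charge_eq0 : forall i j, (mm_order < i)%N || (mm_order < j)%N ->
    forall A, measurable A -> mm_charge i j A = 0%E;
  mm_integrable : forall (i j : nat) (p q : {poly R}),
    charge_integrable (mm_charge i j) (mm_supp i j)
      (fun x => derive1n i (horner p) x * derive1n j (horner q) x)
}.

Definition sobolev_form (R : realType) (W : measure_matrix R) (f h : R -> R) : R :=
  \sum_(n < (mm_order W).+1) \sum_(r < (mm_order W).+1)
    charge_integral (mm_charge W n r) (mm_supp W n r)
      (fun x => derive1n n f x * derive1n r h x).

Definition moment_matrix (R : realType) (W : measure_matrix R) : smx R :=
  fun n p => sobolev_form W (fun x => x ^+ n) (fun x => x ^+ p).

Section Germs.
Variables (R : realType) (d : nat) (r : 'I_d -> R) (m : 'I_d -> nat).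

Definition germ (f : R -> R) : 'rV[R]_(\sum_(i < d) m i) :=
  \mxrow_(i < d) \row_(j < m i) (derive1n j f (r i) / (j`!)%:R).

Definition germ_col (k : nat) (F : 'I_k -> R -> R) :
    'M[R]_(k, \sum_(i < d) m i) :=
  \matrix_(a < k) germ (F a).

End Germs.

(* The last quasi-determinant D - C A^-1 B, for a scalar lower right corner D.
   As invmx A = A for singular A, its use must come with A \in unitmx. *)
Definition Theta (R : realType) (k : nat)
    (A : 'M[R]_k) (B : 'cV[R]_k) (C : 'rV[R]_k) (D : R) : R :=
  D - (C *m invmx A *m B) 0 0.

(* Main.v *)
Require Import Defs.
From HB Require Import structures.
From mathcomp Require Import all_boot all_order all_algebra.
From mathcomp Require Import all_classical all_reals all_analysis.
Import Order.TTheory GRing.Theory Num.Theory.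
Local Open Scope ring_scope.

(** The argument is algebraic: of the moment matrix G it only uses the bilinear
    form <f, g> = sum_ij f_i G_ij g_j on polynomials. An LU factorization of G
    amounts to two monic sequences p_n, q_n with <p_i, q_j> = h_i delta_ij and
    h_i <> 0 ([LU_biorthogonal]), and R(Lambda) G is the matrix of the form
    (f, g) |-> <R f, g> ([poly_form_horner_shift]), whose sequences are denoted
    pL_n, qL_n and hL_n.

    The polynomial R pL_n is monic of degree n + M and orthogonal to q_j for
    j < n, hence
      R pL_n = w_0 p_n + ... + w_(M-1) p_(n+M-1) + p_(n+M)
    with w_0 = hL_n / h_n ([connection_expansion], [connection_coef0]). Its germs
    at the zeros of R vanish, which is a linear system for w whose matrix is the
    germ matrix of p_n, ..., p_(n+M-1). Solving it gives the quasi-determinants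
    for pL_n and for hL_n / h_n.

    The system is uniquely solvable ([germ_window_unit]): a polynomial has
    vanishing germs iff R divides it ([germ_eq0]), and a combination R T of
    p_n, ..., p_(n+M-1) has deg T < n and <R T, g> = 0 whenever deg g < n, so
    T = 0 because the truncations of R(Lambda) G are invertible.

    For qL_n, let K and KL be the kernels of order n + 1 of the two forms. Then
    R(y) KL(x, y) and K(x, y), as polynomials in y, reproduce all g with
    deg g <= n, so they differ by a combination of p_(n+1), ..., p_(n+M) in y,
    in which p_(n+M) has coefficient qL_n(x) / hL_n ([kernel_connection]).
    Taking germs in y again gives a linear system, whose last unknown is the
    sought quotient.

    The formulas for the right transform follow by transposing G, which
    exchanges the two sequences. *)

Set Implicit Arguments.
Unset Strict Implicit.

(** * Moment functionals and biorthogonal polynomials *)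

Section MomentFunctional.
Variable R : realType.
Implicit Types (u : nat -> R) (p q : {poly R}).

(** The linear functional on polynomials with moments u 0, u 1, u 2, etc. *)
Definition moment_fun u p : R := \sum_(i < size p) p`_i * u i.

Lemma moment_fun_widen n u p : (size p <= n)%N ->
  moment_fun u p = \sum_(i < n) p`_i * u i.
Proof.
move=> le_pn; rewrite /moment_fun (big_ord_widen n (fun i => p`_i * u i)) //.
rewrite big_mkcond; apply: eq_bigr => i _.
by case: ltnP => // /(nth_default 0) ->; rewrite mul0r.
Qed.

Lemma moment_fun_is_linear u : linear (moment_fun u : {poly R} -> R^o).
Proof.
move=> a p q; set n := maxn (size p) (size q).
rewrite !(@moment_fun_widen n) ?leq_maxl ?leq_maxr //; last first.
  by rewrite (leq_trans (size_polyD _ _)) // geq_max leq_maxr andbT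
    (leq_trans (size_scale_leq _ _)) // leq_maxl.
rewrite scaler_sumr -big_split; apply: eq_bigr => i _ /=.
by rewrite coefD coefZ mulrDl -mulrA.
Qed.

HB.instance Definition _ u := GRing.isLinear.Build R {poly R} R^o _
  (moment_fun u) (moment_fun_is_linear u).

Lemma moment_funXn u n : moment_fun u 'X^n = u n.
Proof.
rewrite /moment_fun size_polyXn big_ord_recr /= coefXn eqxx mul1r big1 ?add0r //.
by move=> i _; rewrite coefXn (ltn_eqF (ltn_ord i)) mul0r.
Qed.

(** Multiplying the argument by d amounts to replacing the moments of the
    functional by those of its d-modification. *)
Lemma moment_funM u (d p : {poly R}) :
  moment_fun u (d * p) = moment_fun (fun i => moment_fun u (d * 'X^i)) p.
Proof.
rewrite -{1}(coefK p) poly_def mulr_sumr linear_sum; apply: eq_bigr => i _ /=.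
by rewrite -scalerAr linearZ.
Qed.

(** The bilinear form on polynomials with moment matrix G. *)
Definition poly_form (G : smx R) p q : R :=
  moment_fun (fun i => moment_fun (G i) q) p.

(** Transposition exchanges the two families of biorthogonal polynomials, so
    every one-sided statement also yields its mirror image. *)
Lemma poly_form_tr G p q : poly_form (smx_tr G) q p = poly_form G p q.
Proof.
rewrite /poly_form /moment_fun; under eq_bigr do rewrite big_distrr.
rewrite exchange_big; apply: eq_bigr => i _; rewrite big_distrr.
by apply: eq_bigr => j _ /=; rewrite mulrCA.
Qed.

Lemma poly_form_suml (G : smx R) n (c : 'I_n -> R) (p : 'I_n -> {poly R}) q :
  poly_form G (\sum_(i < n) c i *: p i) q = \sum_(i < n) c i * poly_form G (p i) q.
Proof. by rewrite /poly_form linear_sum; apply: eq_bigr => i _; rewrite linearZ. Qed.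

Lemma poly_form_subl (G : smx R) p1 p2 q :
  poly_form G (p1 - p2) q = poly_form G p1 q - poly_form G p2 q.
Proof. by rewrite /poly_form linearB. Qed.

End MomentFunctional.

Section Biorthogonal.
Variable R : realType.

(** The matrix identity S1 G S2^T = H, read on the rows of S1 and S2 as
    polynomials. *)
Record biorthogonal (G : smx R) (p q : nat -> {poly R}) (h : nat -> R) : Prop :=
  Biorthogonal {
    biorth_monicl : forall n, p n \is monic;
    biorth_sizel : forall n, size (p n) = n.+1;
    biorth_monicr : forall n, q n \is monic;
    biorth_sizer : forall n, size (q n) = n.+1;
    biorthE : forall i j, poly_form G (p i) (q j) = h i *+ (i == j);
    biorth_neq0 : forall n, h n != 0 }.

Lemma biorthogonal_tr G p q h :
  biorthogonal G p q h -> biorthogonal (smx_tr G) q p h.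
Proof.
case=> mp sp mq sq E h0; split=> // i j.
by rewrite poly_form_tr E eq_sym; case: eqP => // ->.
Qed.

(** The leading terms cancel. *)
Lemma size_monicB (p q : {poly R}) n : p \is monic -> q \is monic ->
  size p = n.+1 -> size q = n.+1 -> (size (p - q)%R <= n)%N.
Proof.
move=> mp mq sp sq; apply/leq_sizeP => j; rewrite leq_eqVlt => /orP[/eqP <-|lt_nj].
  have := monicP mp; have := monicP mq; rewrite /lead_coef sp sq /= coefB.
  by move=> -> ->; rewrite subrr.
by rewrite coefB !nth_default ?subrr ?sp ?sq.
Qed.

(** The Christoffel-Darboux kernel as a polynomial in its second variable. *)
Definition kernel_poly (q p : nat -> {poly R}) (h : nat -> R) n x : {poly R} :=
  \sum_(k < n) ((q k).[x] / h k) *: p k.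

Section Expansion.
Variables (G : smx R) (p q : nat -> {poly R}) (h : nat -> R).
Hypothesis B : biorthogonal G p q h.

Lemma monic_basis_span N (f : {poly R}) : (size f <= N)%N ->
  exists c : nat -> R, f = \sum_(k < N) c k *: p k.
Proof.
elim: N f => [|N IHN] f.
  rewrite leqn0 size_poly_eq0 => /eqP ->.
  by exists (fun=> 0); rewrite big_ord0.
move=> sf; have [c Ec] : exists c : nat -> R, f - f`_N *: p N = \sum_(k < N) c k *: p k.
  apply: IHN; apply/leq_sizeP => j; rewrite leq_eqVlt => /orP[/eqP <-|lt_Nj].
    have := monicP (biorth_monicl B N).
    rewrite /lead_coef (biorth_sizel B) coefB coefZ /= => ->.
    by rewrite mulr1 subrr.
  rewrite coefB coefZ (nth_default 0 (leq_trans sf lt_Nj)) (nth_default 0 (n := j)).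
    by rewrite mulr0 subrr.
  by rewrite (biorth_sizel B).
exists (fun k => if k == N then f`_N else c k).
rewrite big_ord_recr /= eqxx; under eq_bigr => k _ do rewrite (ltn_eqF (ltn_ord k)).
by rewrite -Ec subrK.
Qed.

Lemma biorth_expansion N (f : {poly R}) : (size f <= N)%N ->
  f = \sum_(k < N) (poly_form G f (q k) / h k) *: p k.
Proof.
move=> /monic_basis_span[c Ef]; rewrite {1}Ef; apply: eq_bigr => k _.
rewrite Ef poly_form_suml (bigD1 k) //= big1 ?addr0.
  by rewrite (biorthE B) eqxx mulr1n mulfK // (biorth_neq0 B).
by move=> i /negPf ik; rewrite (biorthE B) val_eqE ik mulr0.
Qed.

(** Such an f only involves p 0, ..., p n.-1. *)
Lemma biorth_low (f : {poly R}) n : (size f <= n)%N -> poly_form G f (q n) = 0.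
Proof.
move=> /biorth_expansion ->; rewrite poly_form_suml big1 // => i _.
by rewrite (biorthE B) (ltn_eqF (ltn_ord i)) mulr0.
Qed.

(** A monic f of degree n differs from p n by a polynomial of lower degree,
    to which q n is orthogonal. *)
Lemma biorth_monic (f : {poly R}) n : f \is monic -> size f = n.+1 ->
  poly_form G f (q n) = h n.
Proof.
move=> mf sf; have /biorth_low := size_monicB mf (biorth_monicl B n) sf (biorth_sizel B n).
by rewrite poly_form_subl (biorthE B) eqxx mulr1n => /eqP; rewrite subr_eq0 => /eqP.
Qed.

Lemma biorth_expansion_tail n M (f : {poly R}) : (size f <= n + M)%N ->
    (forall j, (j < n)%N -> poly_form G f (q j) = 0) ->
  f = \sum_(a < M) (poly_form G f (q (n + a)%N) / h (n + a)%N) *: p (n + a)%N.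
Proof.
move=> /biorth_expansion Ef f0; rewrite {1}Ef big_split_ord /= big1 ?add0r //.
by move=> i _; rewrite f0 // mul0r scale0r.
Qed.

End Expansion.

Section DualExpansion.
Variables (G : smx R) (p q : nat -> {poly R}) (h : nat -> R).
Hypothesis B : biorthogonal G p q h.

Lemma biorth_expansion_dual n (f : {poly R}) : (size f <= n)%N ->
  f = \sum_(k < n) (poly_form G (p k) f / h k) *: q k.
Proof.
move=> sf; rewrite {1}(biorth_expansion (biorthogonal_tr B) sf).
by apply: eq_bigr => k _; rewrite poly_form_tr.
Qed.

Lemma biorth_low_dual (f : {poly R}) n :
  (size f <= n)%N -> poly_form G (p n) f = 0.
Proof. by rewrite -poly_form_tr; exact: (biorth_low (biorthogonal_tr B)). Qed.

Lemma biorth_monic_dual (f : {poly R}) n : f \is monic -> size f = n.+1 ->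
  poly_form G (p n) f = h n.
Proof. by rewrite -poly_form_tr; exact: (biorth_monic (biorthogonal_tr B)). Qed.

(** For fixed x, the coefficients of the kernel polynomial are exactly those of
    f in the dual basis q, evaluated at x. *)
Lemma kernel_reproducing n (f : {poly R}) x : (size f <= n)%N ->
  poly_form G (kernel_poly q p h n x) f = f.[x].
Proof.
move=> sf; rewrite poly_form_suml.
rewrite [in RHS](biorth_expansion_dual sf) horner_sum.
by apply: eq_bigr => k _; rewrite hornerZ mulrAC -mulrA mulrC -mulrA.
Qed.

Lemma size_kernel_poly n x : (size (kernel_poly q p h n x) <= n)%N.
Proof.
rewrite (leq_trans (size_sum _ _ _)) //; apply/bigmax_leqP => i _.
by rewrite (leq_trans (size_scale_leq _ _)) // (biorth_sizel B).
Qed.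

End DualExpansion.

End Biorthogonal.

(** * Multiplying the form by a polynomial *)

Section ChristoffelPerturbation.
Variable R : realType.
Variables (G GL : smx R) (D : {poly R}) (M : nat).
Variables (p q pL qL : nat -> {poly R}) (h hL : nat -> R).
Hypothesis GL_form : forall f g, poly_form GL f g = poly_form G (D * f) g.
Hypothesis D_monic : D \is monic.
Hypothesis D_size : size D = M.+1.
Hypothesis B : biorthogonal G p q h.
Hypothesis BL : biorthogonal GL pL qL hL.

Lemma size_Dmul n (f : {poly R}) : f \is monic -> size f = n.+1 ->
  size (D * f)%R = (n + M).+1.
Proof.
move=> mf sf; rewrite size_monicM ?monic_neq0 // D_size sf.
by rewrite addnS /= addSn addnC.
Qed.

(** Entry (n, n + a) of the connection matrix, the upper triangular matrix with M
    superdiagonals that expresses the D * pL n in terms of the p k. *)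
Definition connection_coef n a := poly_form G (D * pL n) (q (n + a)%N) / h (n + a)%N.

(** The product D * pL n has degree n + M, so no p k with k > n + M occurs; and
    it is orthogonal to q 0, ..., q n.-1 because pL n is so for the perturbed
    form, so no p k with k < n occurs. *)
Lemma connection_expansion n :
  D * pL n = \sum_(a < M) connection_coef n a *: p (n + a)%N + p (n + M)%N.
Proof.
have sD := size_Dmul (biorth_monicl BL n) (biorth_sizel BL n).
have mD : D * pL n \is monic by rewrite monicMl // (biorth_monicl BL).
have sd := size_monicB mD (biorth_monicl B (n + M)) sD (biorth_sizel B _).
apply/eqP; rewrite -subr_eq; apply/eqP.
have pq0 k : (k < n + M)%N -> poly_form G (p (n + M)%N) (q k) = 0.
  by move=> lt_k; rewrite (biorthE B) eq_sym (ltn_eqF lt_k).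
rewrite {1}(biorth_expansion_tail B sd).
  apply: eq_bigr => a _; rewrite /connection_coef poly_form_subl pq0 ?subr0 //.
  by rewrite ltn_add2l.
move=> j lt_jn; rewrite poly_form_subl pq0 ?subr0 ?ltn_addr //.
by rewrite -GL_form (biorth_low_dual BL) // (biorth_sizer B).
Qed.

Lemma connection_coef0 n : connection_coef n 0 = hL n / h n.
Proof.
rewrite /connection_coef addn0 -GL_form.
by rewrite (biorth_monic_dual BL) ?(biorth_sizer B) ?(biorth_monicr B).
Qed.

(** Both D times the perturbed kernel and the unperturbed kernel reproduce the
    polynomials of degree at most n, so their difference only involves
    p n.+1, ..., p (n + M). The last coefficient comes from the only summand of
    degree n + M in y, namely the one with k = n, which is monic up to its
    factor (qL n).[x] / hL n. *)
Lemma kernel_connection n x : (0 < M)%N -> exists2 c : nat -> R,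
  D * kernel_poly qL pL hL n.+1 x =
    kernel_poly q p h n.+1 x + \sum_(a < M) c a *: p (n.+1 + a)%N &
  c M.-1 = (qL n).[x] / hL n.
Proof.
move=> M_gt0; set KL := kernel_poly qL _ _ _ _; set K := kernel_poly q _ _ _ _.
pose c a := poly_form G (D * KL - K) (q (n.+1 + a)%N) / h (n.+1 + a)%N.
exists c.
  apply/eqP; rewrite addrC -subr_eq; apply/eqP.
  apply: (biorth_expansion_tail B) => [|j le_jn].
    rewrite (leq_trans (size_polyD _ _)) // geq_max size_polyN; apply/andP; split.
      rewrite (leq_trans (size_polyMleq _ _)) // D_size addSn /= addnC leq_add2r.
      exact: (size_kernel_poly BL).
    exact: leq_trans (size_kernel_poly B _ _) (leq_addr _ _).
  rewrite poly_form_subl -GL_form (kernel_reproducing BL) ?(biorth_sizer B) //.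
  by rewrite (kernel_reproducing B) ?(biorth_sizer B) // subrr.
(* With a = M.-1 the index n.+1 + a is n + M. *)
rewrite /c addSnnS prednK // poly_form_subl [X in _ - X](biorth_low B); last first.
  rewrite (leq_trans (size_kernel_poly B _ _)) //.
  by rewrite -addn1 leq_add2l.
rewrite subr0 /KL /kernel_poly mulr_sumr.
under eq_bigr => k _ do rewrite -scalerAr.
rewrite poly_form_suml big_ord_recr big1 /= ?add0r; last first.
  move=> k _; rewrite (biorth_low B) ?mulr0 //.
  by rewrite (size_Dmul (biorth_monicl BL k) (biorth_sizel BL k)) ltn_add2r.
rewrite (biorth_monic B) ?mulfK ?(biorth_neq0 B) //.
  by rewrite monicMl // (biorth_monicl BL).
exact: size_Dmul (biorth_monicl BL n) (biorth_sizel BL n).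
Qed.

(** Write the combination as D * T. Then T has degree less than n and is
    orthogonal, for the perturbed form, to all polynomials of degree less than
    n; nondegeneracy of that form in degrees below n forces T = 0. *)
Lemma no_multiple_in_window n (v : 'I_M -> R) :
  D %| \sum_(a < M) v a *: p (n + a)%N -> \sum_(a < M) v a *: p (n + a)%N = 0.
Proof.
set Q := \sum_(a < M) _ => /dvdpP[T]; rewrite mulrC => EQ.
have sQ : (size Q <= n + M)%N.
  rewrite (leq_trans (size_sum _ _ _)) //; apply/bigmax_leqP => i _.
  by rewrite (leq_trans (size_scale_leq _ _)) // (biorth_sizel B) -addnS leq_add2l.
have [T0|T0] := eqVneq T 0; first by rewrite EQ T0 mulr0.
have sT : (size T <= n)%N.
  move: sQ; rewrite EQ size_monicM // D_size addSn /= addnC leq_add2r //.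
rewrite EQ (biorth_expansion BL sT) big1 ?mulr0 // => k _.
rewrite GL_form -EQ /Q poly_form_suml big1 ?mul0r ?scale0r // => a _.
rewrite (biorth_low_dual B) ?mulr0 //.
by rewrite (biorth_sizer BL) ltn_addr.
Qed.

Lemma window_free n (v : 'I_M -> R) :
  \sum_(a < M) v a *: p (n + a)%N = 0 -> forall a, v a = 0.
Proof.
move=> Q0 a; have: poly_form G (\sum_(a < M) v a *: p (n + a)%N) (q (n + a)%N) = 0.
  by rewrite Q0 /poly_form linear0.
rewrite poly_form_suml (bigD1 a) //= big1 ?addr0 => [|b /negPf ba].
  rewrite (biorthE B) eqxx mulr1n => /eqP; rewrite mulf_eq0.
  by rewrite (negPf (biorth_neq0 B _)) orbF => /eqP.
by rewrite (biorthE B) eqn_add2l val_eqE ba mulr0.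
Qed.

End ChristoffelPerturbation.

(** * Germs of polynomials *)

Section GermsOfPolynomials.
Variable R : realType.
Implicit Types (p : {poly R}) (c : R).

Lemma derive1n_horner p n : derive1n n (horner p) = horner p^`(n).
Proof. by elim: n => // n IHn; rewrite derive1nS IHn derivnS derivE. Qed.

Lemma dvdp_XsubC_exp_deriv p c k :
  ('X - c%:P) ^+ k.+1 %| p -> ('X - c%:P) ^+ k %| p^`().
Proof.
case/dvdpP=> q ->; rewrite derivM deriv_exp derivXsubC mul1r dvdp_add //.
  by rewrite dvdp_mull // dvdp_exp2l.
by rewrite dvdp_mull // -mulr_natl dvdp_mull.
Qed.

(** Taylor expansion at c. *)
Lemma dvdp_XsubC_exp p c m :
  reflect (forall j : 'I_m, p^`N(j).[c] = 0) (('X - c%:P) ^+ m %| p).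
Proof.
apply: (iffP idP) => [Dp j | p0].
  have Dj : ('X - c%:P) ^+ (m - j) %| p^`(j).
    elim: (nat_of_ord j) (ltnW (ltn_ord j)) => [|k IHk] lt_km; first by rewrite subn0.
    by rewrite derivnS dvdp_XsubC_exp_deriv // -subSn // subSS IHk // ltnW.
  have : root p^`(j) c.
    by rewrite -dvdp_XsubCl (dvdp_trans _ Dj) // dvdp_exp // subn_gt0.
  rewrite /root nderivn_def hornerMn mulrn_eq0.
  by rewrite (gtn_eqF (fact_gt0 j)) => /eqP.
(* Taylor's formula in {poly R}, with 'X = c + ('X - c). *)
have Ep : p = \sum_(i < size p) (p^`N(i).[c])%:P * ('X - c%:P) ^+ i.
  rewrite -[LHS]comp_polyXr -{1}(subrK c%:P 'X) addrC /comp_poly.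
  rewrite nderiv_taylor; last exact: mulrC.
  rewrite size_map_polyC; apply: eq_bigr => i _.
  by rewrite nderivn_map horner_map.
rewrite Ep; elim/big_ind: _ => [|u v|i _]; [exact: dvdp0 | exact: dvdp_add|].
have [lt_im|le_mi] := ltnP i m; last by rewrite dvdp_mull // dvdp_exp2l.
by rewrite (p0 (Ordinal lt_im)) mul0r dvdp0.
Qed.

Variables (d : nat) (r : 'I_d -> R) (m : 'I_d -> nat).

Lemma germ_horner p :
  germ r m (horner p) = \mxrow_(i < d) \row_(j < m i) p^`N(j).[r i].
Proof.
apply: eq_mxrow => i; apply/rowP => j; rewrite !mxE derive1n_horner nderivn_def.
by rewrite hornerMn -[X in X / _]mulr_natr mulfK // pnatr_eq0 -lt0n fact_gt0.
Qed.

(** The powers of the distinct linear factors are pairwise coprime, so their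
    product divides p as soon as each of them does. *)
Lemma germ_eq0 p : injective r ->
  germ r m (horner p) = 0 <-> \prod_(i < d) ('X - (r i)%:P) ^+ m i %| p.
Proof.
move=> r_inj; rewrite germ_horner; split=> [p0|].
  have Dp i : ('X - (r i)%:P) ^+ m i %| p.
    apply/dvdp_XsubC_exp => j; move: (congr1 (fun A => submxrow A i) p0).
    by rewrite mxrowK submxrow0 => /rowP/(_ j); rewrite !mxE.
  suff: forall s : seq 'I_d, uniq s -> \prod_(i <- s) ('X - (r i)%:P) ^+ m i %| p.
    by apply; exact: index_enum_uniq.
  elim=> [|i s IHs] /=; first by rewrite big_nil dvd1p.
  case/andP=> is_s us; rewrite big_cons Gauss_dvdp ?Dp ?IHs //.
  rewrite big_seq; elim/big_rec: _ => [|j q js]; first exact: coprimep1.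
  rewrite coprimepMr => ->; rewrite andbT coprimep_expl // coprimep_expr //.
  rewrite coprimep_XsubC2 // subr_eq0; apply: contraNneq is_s => rij.
  by rewrite -(r_inj _ _ rij).
move=> Dp; rewrite -[RHS](mxrow0 (q_ := m)); apply: eq_mxrow => i.
apply/rowP => j; rewrite !mxE; apply/dvdp_XsubC_exp.
by rewrite (dvdp_trans _ Dp) // (bigD1 i) //= dvdp_mulIl.
Qed.

Lemma germ_sum n (c : 'I_n -> R) (p : 'I_n -> {poly R}) :
  germ r m (horner (\sum_(a < n) c a *: p a)) =
  \sum_(a < n) c a *: germ r m (horner (p a)).
Proof.
apply/rowP => k; rewrite summxE germ_horner !mxE linear_sum horner_sum.
by apply: eq_bigr => a _; rewrite germ_horner !mxE linearZ hornerZ.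
Qed.

Lemma germD p q :
  germ r m (horner (p + q)) = germ r m (horner p) + germ r m (horner q).
Proof. by apply/rowP => k; rewrite !germ_horner !mxE linearD hornerD. Qed.

Lemma mulmx_germ_col n (v : 'rV[R]_n) (p : 'I_n -> {poly R}) :
  v *m germ_col r m (fun a => horner (p a)) =
  germ r m (horner (\sum_(a < n) v 0 a *: p a)).
Proof.
by rewrite mulmx_sum_row germ_sum; apply: eq_bigr => a _; rewrite rowK.
Qed.

End GermsOfPolynomials.

(** * Semi-infinite matrix products *)

Section SemiInfiniteProducts.
Variable R : realType.
Implicit Types (A B S T U : smx R) (i j k N : nat).

(** Products are not associative in general. Finite sums, and truncations when
    one factor is triangular, reduce them to ordinary matrix products, which
    are. *)
Lemma smx_mulE N A B i j : (forall k, (N <= k)%N -> A i k * B k j = 0) ->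
  smx_mul A B i j = \sum_(k < N) A i k * B k j.
Proof.
move=> AB0; rewrite (fsbig_ord _ _ (fun k => A i k * B k j)); apply: esym.
apply: fsbig_widen => // k [_ /= /negP]; rewrite -leqNgt; exact: AB0.
Qed.

Lemma smx_mul_lower S A i j : (forall k, (i < k)%N -> S i k = 0) ->
  smx_mul S A i j = \sum_(k < i.+1) S i k * A k j.
Proof. by move=> S0; apply: smx_mulE => k lt_ik; rewrite S0 // mul0r. Qed.

Definition lower_triangular A := forall i j, (i < j)%N -> A i j = 0.

Lemma smx_mul_lower_trunc S A k : lower_triangular S ->
  smx_trunc (smx_mul S A) k = smx_trunc S k *m smx_trunc A k.
Proof.
move=> S0; apply/matrixP => i j; rewrite !mxE (@smx_mulE k) => [|l le_kl].
  by apply: eq_bigr => l _; rewrite !mxE.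
by rewrite S0 ?mul0r // (leq_trans (ltn_ord i)).
Qed.

Lemma smx_mul_upper_trunc A S k : lower_triangular S ->
  smx_trunc (smx_mul A (smx_tr S)) k = smx_trunc A k *m (smx_trunc S k)^T.
Proof.
move=> S0; apply/matrixP => i j; rewrite !mxE (@smx_mulE k) => [|l le_kl].
  by apply: eq_bigr => l _; rewrite !mxE.
by rewrite /smx_tr S0 ?mulr0 // (leq_trans (ltn_ord j)).
Qed.

Lemma smx_trunc_inj A B : (forall k, smx_trunc A k = smx_trunc B k) -> A = B.
Proof.
move=> AB; apply/funext => i; apply/funext => j.
have lti : (i < (maxn i j).+1)%N by rewrite ltnS leq_maxl.
have ltj : (j < (maxn i j).+1)%N by rewrite ltnS leq_maxr.
by have /matrixP/(_ (Ordinal lti) (Ordinal ltj)) := AB (maxn i j).+1; rewrite !mxE.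
Qed.

Lemma smx_trunc1 k : smx_trunc (smx1 R) k = 1%:M.
Proof. by apply/matrixP => i j; rewrite !mxE. Qed.

(** Forward substitution along the rows of S T = 1. *)
Lemma smx_inverse_lower S T :
  lower_unitriangular S -> smx_inverse S T -> lower_triangular T.
Proof.
move=> [S1 S0] [ST _]; elim/ltn_ind => i IHi j lt_ij.
have := congr1 (fun A : smx R => A i j) ST.
rewrite (smx_mul_lower _ _ (S0 i)) big_ord_recr /= S1 mul1r big1 => [|k _].
  by rewrite add0r /smx1 (ltn_eqF lt_ij).
by rewrite IHi ?mulr0 // (ltn_trans (ltn_ord k)).
Qed.

Lemma shift_mulE A i j : smx_mul (smx_shift R) A i j = A i.+1 j.
Proof.
rewrite (@smx_mulE i.+2) => [|k lt_ik]; last by rewrite /smx_shift (ltn_eqF lt_ik) mul0r.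
rewrite big_ord_recr /= /smx_shift eqxx mul1r big1 ?add0r // => k _.
by rewrite (gtn_eqF (ltn_ord k)) mul0r.
Qed.

Lemma shift_expE n i j : smx_exp (smx_shift R) n i j = ((i + n)%N == j)%:R.
Proof.
elim: n i => [|n IHn] i; first by rewrite addn0.
by rewrite /smx_exp iterS shift_mulE [LHS]IHn addSnnS.
Qed.

Lemma horner_shift_mulE (p : {poly R}) A i j :
  smx_mul (smx_horner p (smx_shift R)) A i j = \sum_(k < size p) p`_k * A (i + k)%N j.
Proof.
rewrite (@smx_mulE (i + size p)%N) => [|k le_k].
  under eq_bigr do rewrite /smx_horner big_distrl.
  rewrite exchange_big; apply: eq_bigr => k _ /=.
  have lt_k : (i + k < i + size p)%N by rewrite ltn_add2l.
  rewrite (bigD1 (Ordinal lt_k)) //= shift_expE eqxx mulr1 big1 ?addr0 // => l.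
  rewrite -val_eqE /= eq_sym shift_expE => /negPf ->.
  by rewrite mulr0 mul0r.
rewrite /smx_horner big1 ?mul0r // => l _; rewrite shift_expE ltn_eqF ?mulr0 //.
by rewrite (leq_trans _ le_k) // ltn_add2l.
Qed.

Lemma moment_funMXn u (p : {poly R}) i :
  moment_fun u (p * 'X^i) = \sum_(k < size p) p`_k * u (i + k)%N.
Proof.
rewrite -{1}(coefK p) poly_def mulr_suml linear_sum; apply: eq_bigr => k _.
by rewrite -scalerAl linearZ /= -exprD moment_funXn addnC.
Qed.

Lemma poly_form_horner_shift (p : {poly R}) A f g :
  poly_form (smx_mul (smx_horner p (smx_shift R)) A) f g = poly_form A (p * f) g.
Proof.
rewrite -poly_form_tr -(poly_form_tr A); apply: eq_bigr => j _.
congr (_ * _); rewrite moment_funM; apply: eq_bigr => i _; congr (_ * _).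
by rewrite /smx_tr horner_shift_mulE moment_funMXn.
Qed.

Lemma smx_mul_tr A B : smx_tr (smx_mul A B) = smx_mul (smx_tr B) (smx_tr A).
Proof.
apply/funext => i; apply/funext => j; apply: eq_fsbigr => k _; exact: mulrC.
Qed.

End SemiInfiniteProducts.

(** * LU factorization *)

Section LUFactorization.
Variable R : realType.
Implicit Types (G S T : smx R) (h : nat -> R) (i j k n : nat).

Lemma det_lower_unitriangular_trunc S k :
  lower_unitriangular S -> \det (smx_trunc S k) = 1.
Proof.
move=> [S1 S0]; rewrite det_trig; first by rewrite big1 // => i _; rewrite !mxE.
by apply/is_trig_mxP => i j; rewrite mxE; exact: S0.
Qed.

Lemma LU_factorizable_tr G : LU_factorizable G -> LU_factorizable (smx_tr G).
Proof.
move=> GLU k k_gt0; rewrite (_ : smx_trunc _ k = (smx_trunc G k)^T) ?det_tr ?GLU //.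
by apply/matrixP => i j; rewrite !mxE.
Qed.

(** Row i of S solves the linear system with matrix the i-th truncation of G,
    which is invertible: the Gram-Schmidt step that defines the monic orthogonal
    polynomials. *)
Lemma LU_factorizable_orthogonalize G : LU_factorizable G ->
  exists2 S, lower_unitriangular S & forall i j, (j < i)%N -> smx_mul S G i j = 0.
Proof.
move=> GLU.
have /choice[S HS] : forall n, exists s : nat -> R, [/\ s n = 1,
    forall k, (n < k)%N -> s k = 0 &
    forall j, (j < n)%N -> \sum_(k < n.+1) s k * G k j = 0].
  move=> n; have Gu : smx_trunc G n \in unitmx.
    by case: n => [|n]; rewrite unitmxE unitfE ?det_mx00 ?oner_neq0 ?GLU.
  pose c := - (\row_(j < n) G n j) *m invmx (smx_trunc G n).
  pose s k := if insub k is Some k' then c 0 k' else (k == n)%:R.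
  have s_ge k : (n <= k)%N -> s k = (k == n)%:R.
    by move=> le_nk; rewrite /s insubN // -leqNgt.
  exists s; split=> [|k lt_nk|j lt_jn]; first by rewrite s_ge // eqxx.
    by rewrite s_ge ?(gtn_eqF lt_nk) // ltnW.
  rewrite big_ord_recr /= s_ge // eqxx mul1r.
  under eq_bigr => k _ do rewrite /s valK.
  have /rowP/(_ (Ordinal lt_jn)) := mulmxKV Gu (- (\row_(j < n) G n j)).
  rewrite !mxE => Ec; apply/eqP; rewrite addr_eq0 -Ec; apply/eqP.
  by apply: eq_bigr => k _; rewrite !mxE.
exists S; first by split=> [i|i j]; have [? + _] := HS i; auto.
move=> i j lt_ji; have [_ S0 SG] := HS i.
by rewrite smx_mul_lower ?SG.
Qed.

(** Orthogonalizing S itself gives T with T S both lower unitriangular and upper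
    triangular, hence T S = 1; the other identity follows on truncations. *)
Lemma lower_unitriangular_inverse S : lower_unitriangular S ->
  exists T, smx_inverse S T.
Proof.
move=> Su; have [S1 S0] := Su.
have [k k_gt0|T Tu TS0] := @LU_factorizable_orthogonalize S.
  by rewrite det_lower_unitriangular_trunc ?oner_neq0.
have [T1 T0] := Tu; exists T.
have TS : smx_mul T S = smx1 R.
  apply/funext => i; apply/funext => j; rewrite /smx1.
  have [lt_ij|/TS0 -> //|->] := ltngtP i j; rewrite (smx_mul_lower _ _ (T0 _)).
    by rewrite big1 // => k _; rewrite S0 ?mulr0 // (leq_trans (ltn_ord k)).
  rewrite big_ord_recr /= S1 T1 mulr1 big1 ?add0r // => k _.
  by rewrite S0 ?mulr0.
split=> //; apply: smx_trunc_inj => k; rewrite smx_mul_lower_trunc // smx_trunc1.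
by apply: mulmx1C; rewrite -smx_mul_lower_trunc // TS smx_trunc1.
Qed.

Lemma smx_inverse_trunc S T k : lower_unitriangular S -> smx_inverse S T ->
  smx_trunc S k *m smx_trunc T k = 1%:M.
Proof.
by move=> [_ S0] [ST _]; rewrite -smx_mul_lower_trunc // ST smx_trunc1.
Qed.

(** Orthogonalizing G and its transpose makes S1 G S2^T upper and lower
    triangular at once, hence diagonal. *)
Lemma LU_exists G : LU_factorizable G -> exists F, is_LU G F.
Proof.
move=> GLU; have [S1 S1u S1G] := LU_factorizable_orthogonalize GLU.
have [S2 S2u S2G] := LU_factorizable_orthogonalize (LU_factorizable_tr GLU).
have S1l := S1u.2; have S2l := S2u.2.
have [T1 ST1] := lower_unitriangular_inverse S1u.
have [T2 ST2] := lower_unitriangular_inverse S2u.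
pose H := smx_mul (smx_mul S1 G) (smx_tr S2).
have HE : H = smx_diag (fun i => H i i).
  apply/funext => i; apply/funext => j; rewrite /smx_diag.
  have [lt_ij|lt_ji|-> //] := ltngtP i j; rewrite mulr0n /H; last first.
    rewrite (@smx_mulE _ j.+1) => [|k lt_jk]; last by rewrite /smx_tr S2l // mulr0.
    by rewrite big1 // => k _; rewrite S1G ?mul0r // (leq_trans (ltn_ord k)).
  have -> : smx_mul (smx_mul S1 G) (smx_tr S2) = smx_mul S1 (smx_mul G (smx_tr S2)).
    apply: smx_trunc_inj => k.
    by rewrite !(smx_mul_upper_trunc, smx_mul_lower_trunc) // mulmxA.
  rewrite (smx_mul_lower _ _ (S1l _)) big1 // => k _.
  rewrite -[smx_mul G _]/(smx_tr (smx_tr _)) smx_mul_tr /smx_tr /= -/(smx_tr G).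
  by rewrite S2G ?mulr0 // (leq_trans (ltn_ord k)).
exists (S1, S2, fun i => H i i); split=> //; exists T1, T2; split=> //.
rewrite -HE; apply: smx_trunc_inj => k.
rewrite smx_mul_upper_trunc; last exact: smx_inverse_lower ST2.
rewrite smx_mul_lower_trunc; last exact: smx_inverse_lower ST1.
rewrite smx_mul_upper_trunc // smx_mul_lower_trunc // !mulmxA.
rewrite (mulmx1C (smx_inverse_trunc k S1u ST1)) mul1mx -mulmxA -trmx_mul.
by rewrite (mulmx1C (smx_inverse_trunc k S2u ST2)) trmx1 mulmx1.
Qed.

Lemma is_LU_trunc G S1 S2 h k : is_LU G (S1, S2, h) ->
  smx_trunc S1 k *m smx_trunc G k *m (smx_trunc S2 k)^T = smx_trunc (smx_diag h) k.
Proof.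
case=> S1u S2u [T1 [T2 [ST1 ST2 ->]]].
rewrite smx_mul_upper_trunc; last exact: smx_inverse_lower ST2.
rewrite smx_mul_lower_trunc; last exact: smx_inverse_lower ST1.
rewrite !mulmxA (smx_inverse_trunc k S1u ST1) mul1mx -mulmxA -trmx_mul.
by rewrite (smx_inverse_trunc k S2u ST2) trmx1 mulmx1.
Qed.

Lemma coef_smx_poly S n k : lower_triangular S -> (smx_poly S n)`_k = S n k.
Proof. by move=> S0; rewrite coef_poly ltnS; case: leqP => // /S0 ->. Qed.

Lemma size_smx_poly S n : lower_unitriangular S -> size (smx_poly S n) = n.+1.
Proof. by move=> [S1 S0]; rewrite size_poly_eq // S1 oner_neq0. Qed.

Lemma monic_smx_poly S n : lower_unitriangular S -> smx_poly S n \is monic.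
Proof.
move=> Su; have [S1 S0] := Su.
by rewrite monicE /lead_coef size_smx_poly // coef_smx_poly // S1.
Qed.

Lemma poly_form_smx_poly G S1 S2 k (i j : 'I_k) :
    lower_unitriangular S1 -> lower_unitriangular S2 ->
  poly_form G (smx_poly S1 i) (smx_poly S2 j) =
    (smx_trunc S1 k *m smx_trunc G k *m (smx_trunc S2 k)^T) i j.
Proof.
move=> S1u S2u; rewrite -mulmxA mxE /poly_form (@moment_fun_widen _ k); last first.
  by rewrite size_smx_poly.
apply: eq_bigr => a _; rewrite coef_smx_poly ?mxE; last exact: S1u.2.
congr (_ * _); rewrite (@moment_fun_widen _ k) ?size_smx_poly //.
by apply: eq_bigr => b _; rewrite coef_smx_poly ?mxE 1?mulrC //; exact: S2u.2.
Qed.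

(** Nonvanishing of h n comes from the determinants of the truncations of size
    n.+1, since the unitriangular factors have determinant 1. *)
Lemma LU_biorthogonal G : LU_factorizable G -> biorthogonal G (P1 G) (P2 G) (LU_h G).
Proof.
move=> GLU; have : is_LU G (LU G).
  by have [F GF] := LU_exists GLU; apply: (xgetI _ (GF : [set F | is_LU G F]%classic F)).
rewrite /P1 /P2 /LU_h /LU_S1 /LU_S2; case: (LU G) => [[S1 S2] h] /= GF.
have [S1u S2u _] := GF; split; [| | | |move=> i j|move=> n].
- by move=> n; exact: monic_smx_poly.
- by move=> n; exact: size_smx_poly.
- by move=> n; exact: monic_smx_poly.
- by move=> n; exact: size_smx_poly.
- have lti : (i < (maxn i j).+1)%N by rewrite ltnS leq_maxl.
  have ltj : (j < (maxn i j).+1)%N by rewrite ltnS leq_maxr.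
  rewrite (@poly_form_smx_poly _ _ _ _ (Ordinal lti) (Ordinal ltj)) //.
  by rewrite (is_LU_trunc _ GF) mxE.
have := congr1 determinant (is_LU_trunc n.+1 GF).
rewrite !det_mulmx det_tr (det_lower_unitriangular_trunc _ S1u).
rewrite (det_lower_unitriangular_trunc _ S2u) mul1r mulr1.
rewrite (_ : smx_trunc (smx_diag h) _ = diag_mx (\row_i h i)); last first.
  by apply/matrixP => i j; rewrite !mxE.
move=> Eh; have := GLU n.+1 isT; rewrite Eh det_diag prodf_seq_neq0 => /allP/(_ ord_max).
by rewrite mem_index_enum mxE => /(_ isT).
Qed.

End LUFactorization.

(** * Quasi-determinantal formulas *)

(** The quasi-determinant solves the linear system v A + c = 0. *)
Lemma ThetaE (R : realType) k (A : 'M[R]_k) b c (v : 'rV[R]_k) e :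
  A \in unitmx -> v *m A + c = 0 -> Theta A b c e = e + (v *m b) 0 0.
Proof.
move=> Au /eqP; rewrite addrC addr_eq0 => /eqP ->.
by rewrite /Theta mulNmx mulmxK // mulNmx mxE opprK.
Qed.

Section ChristoffelQuasideterminants.
Variables (R : realType) (d : nat) (r : 'I_d -> R) (m : 'I_d -> nat).
Hypotheses (r_inj : injective r) (d_gt0 : (0 < d)%N).
Hypothesis m_gt0 : forall i, (0 < m i)%N.
Variables (G : smx R) (p q pL qL : nat -> {poly R}) (h hL : nat -> R).

Let M := (\sum_(i < d) m i)%N.
Let D : {poly R} := \prod_(i < d) ('X - (r i)%:P) ^+ m i.
Let GL := smx_mul (smx_horner D (smx_shift R)) G.

Hypothesis B : biorthogonal G p q h.
Hypothesis BL : biorthogonal GL pL qL hL.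

Let GL_form f g : poly_form GL f g = poly_form G (D * f) g.
Proof. exact: poly_form_horner_shift. Qed.

Let D_monic : D \is monic.
Proof. by apply: monic_prod => i _; apply: monic_exp; exact: monicXsubC. Qed.

Let D_size : size D = M.+1.
Proof.
rewrite size_prod => [|i _]; last by rewrite expf_neq0 // polyXsubC_eq0.
under eq_bigr do rewrite size_exp_XsubC -addn1.
by rewrite big_split /= sum1_card -addSn addnK.
Qed.

Let M_gt0 : (0 < M)%N.
Proof. by rewrite /M (bigD1 (Ordinal d_gt0)) //= addn_gt0 m_gt0. Qed.

Let Pi k : 'M[R]_M := germ_col r m (fun a : 'I_M => horner (p (k + a)%N)).

(** A vector in the row kernel is a combination of p n, ..., p (n + M).-1 that
    is divisible by D. *)
Lemma germ_window_unit n : Pi n \in unitmx.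
Proof.
rewrite -row_free_unit; apply: inj_row_free => v; rewrite mulmx_germ_col.
move=> /(germ_eq0 _ _ r_inj) /(no_multiple_in_window GL_form D_monic D_size B BL).
by move=> /(window_free B) v0; apply/rowP => a; rewrite v0 mxE.
Qed.

Let w n : 'rV[R]_M := \row_a connection_coef G D q pL h n a.

(** The product D * pL n has vanishing germs, which determines its connection
    coefficients. *)
Lemma germ_connection n : w n *m Pi n + germ r m (horner (p (n + M)%N)) = 0.
Proof.
rewrite mulmx_germ_col -germD.
have -> : \sum_(a < M) w n 0 a *: p (n + a)%N =
    \sum_(a < M) connection_coef G D q pL h n a *: p (n + a)%N.
  by apply: eq_bigr => a _; rewrite mxE.
apply/(germ_eq0 _ _ r_inj).
by rewrite -(connection_expansion GL_form D_monic D_size B BL) dvdp_mulIl.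
Qed.

Lemma christoffel_poly n x : D.[x] != 0 ->
  (pL n).[x] = D.[x]^-1 *
    Theta (Pi n) (\col_(a < M) (p (n + a)%N).[x])
          (germ r m (horner (p (n + M)%N))) (p (n + M)%N).[x].
Proof.
move=> Dx; rewrite (ThetaE _ _ (germ_window_unit n) (germ_connection n)).
apply: (mulfI Dx); rewrite mulVKf // -hornerM.
rewrite (connection_expansion GL_form D_monic D_size B BL) hornerD addrC mxE.
by congr (_ + _); rewrite horner_sum; apply: eq_bigr => a _; rewrite hornerZ !mxE.
Qed.

Lemma christoffel_norm n :
  hL n / h n = Theta (Pi n) (\col_a (a == 0%N :> nat)%:R)
                     (germ r m (horner (p (n + M)%N))) 0.
Proof.
rewrite (ThetaE _ _ (germ_window_unit n) (germ_connection n)) add0r mxE.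
rewrite (bigD1 (Ordinal M_gt0)) //= !mxE eqxx mulr1 (connection_coef0 GL_form B BL).
rewrite big1 ?addr0 // => a; rewrite -val_eqE !mxE /= => /negPf ->.
by rewrite mulr0.
Qed.

(** The germs of D times the perturbed kernel vanish, which determines the
    coefficients that connect the two kernels, in particular the last one. *)
Lemma christoffel_dual_poly n x :
  (qL n).[x] / hL n =
    Theta (Pi n.+1) (\col_a (a.+1 == M :> nat)%:R)
          (germ r m (horner (kernel_poly q p h n.+1 x))) 0.
Proof.
have [c Ec cM] := kernel_connection GL_form D_monic D_size B BL n x M_gt0.
have Evanish : (\row_(a < M) c a) *m Pi n.+1
    + germ r m (horner (kernel_poly q p h n.+1 x)) = 0.
  rewrite mulmx_germ_col -germD addrC.
  under eq_bigr => a _ do rewrite mxE.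
  by rewrite -Ec; apply/(germ_eq0 _ _ r_inj); exact: dvdp_mulIl.
rewrite (ThetaE _ _ (germ_window_unit _) Evanish) add0r mxE -cM.
have lt_M : (M.-1 < M)%N by rewrite prednK.
rewrite (bigD1 (Ordinal lt_M)) //= !mxE prednK // eqxx mulr1.
rewrite big1 ?addr0 // => a; rewrite -val_eqE !mxE /= -eqSS prednK // => /negPf ->.
by rewrite mulr0.
Qed.

End ChristoffelQuasideterminants.

(** * The Christoffel formulas for both transforms *)

Unset Implicit Arguments.

Theorem proposition18 (R : realType) (W : measure_matrix R)
    (d : nat) (r : 'I_d -> R) (m : 'I_d -> nat)
    (d_gt0 : (0 < d)%N) (r_inj : injective r) (m_gt0 : forall i, (0 < m i)%N) :
  let M := (\sum_(i < d) m i)%N in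
  let Rp : {poly R} := \prod_(i < d) ('X - (r i)%:P) ^+ m i in
  let G := moment_matrix W in
  let GL := smx_mul (smx_horner Rp (smx_shift R)) G in
  let GR := smx_mul G (smx_tr (smx_horner Rp (smx_shift R))) in
  let e_first : 'cV[R]_M := \col_a (a == 0%N :> nat)%:R in
  let e_last : 'cV[R]_M := \col_a (a.+1 == M :> nat)%:R in
  LU_factorizable G -> LU_factorizable GL -> LU_factorizable GR ->
  forall n : nat,
  (let Pi1 k : 'M[R]_M := germ_col r m (fun a : 'I_M => horner (P1 G (k + a)%N)) in
   [/\ Pi1 n \in unitmx /\ Pi1 n.+1 \in unitmx,
       forall x : R, Rp.[x] != 0 ->
         (P1 GL n).[x] = Rp.[x]^-1 *
           Theta (Pi1 n) (\col_(a < M) (P1 G (n + a)%N).[x])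
                 (germ r m (horner (P1 G (n + M)%N))) (P1 G (n + M)%N).[x],
       forall x : R,
         (P2 GL n).[x] / LU_h GL n =
           Theta (Pi1 n.+1) e_last
                 (germ r m (fun y => CD_kernel G n.+1 x y)) 0 &
       LU_h GL n / LU_h G n =
         Theta (Pi1 n) e_first (germ r m (horner (P1 G (n + M)%N))) 0]) /\
  (let Pi2 k : 'M[R]_M := germ_col r m (fun a : 'I_M => horner (P2 G (k + a)%N)) in
   [/\ Pi2 n \in unitmx /\ Pi2 n.+1 \in unitmx,
       forall x : R, Rp.[x] != 0 ->
         (P2 GR n).[x] = Rp.[x]^-1 *
           Theta (Pi2 n) (\col_(a < M) (P2 G (n + a)%N).[x])
                 (germ r m (horner (P2 G (n + M)%N))) (P2 G (n + M)%N).[x],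
       forall x : R,
         (P1 GR n).[x] / LU_h GR n =
           Theta (Pi2 n.+1) e_last
                 (germ r m (fun y => CD_kernel G n.+1 y x)) 0 &
       LU_h GR n / LU_h G n =
         Theta (Pi2 n) e_first (germ r m (horner (P2 G (n + M)%N))) 0]).
Proof.
move=> M D G GL GR e_first e_last GLU GLLU GRLU n.
have B := LU_biorthogonal GLU; have BL := LU_biorthogonal GLLU.
have Bt := biorthogonal_tr B.
(* The right transform of G is the transpose of the left transform of the
   transpose of G. *)
have BR : biorthogonal (smx_mul (smx_horner D (smx_shift R)) (smx_tr G))
    (P2 GR) (P1 GR) (LU_h GR).
  have := biorthogonal_tr (LU_biorthogonal GRLU).
  by rewrite {1}/GR smx_mul_tr.
split=> Pi; split.
- by split; exact: (germ_window_unit r_inj B BL).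
- by move=> x Dx; exact: (christoffel_poly r_inj B BL).
- move=> x; rewrite (christoffel_dual_poly r_inj d_gt0 m_gt0 B BL).
  congr (Theta _ _ (germ r m _) 0); apply/funext => y; rewrite horner_sum.
  by apply: eq_bigr => k _; rewrite hornerZ.
- exact: (christoffel_norm r_inj d_gt0 m_gt0 B BL).
- by split; exact: (germ_window_unit r_inj Bt BR).
- by move=> x Dx; exact: (christoffel_poly r_inj Bt BR).
- move=> x; rewrite (christoffel_dual_poly r_inj d_gt0 m_gt0 Bt BR).
  congr (Theta _ _ (germ r m _) 0); apply/funext => y; rewrite horner_sum.
  by apply: eq_bigr => k _; rewrite hornerZ [RHS]mulrC mulrA mulrAC.
- exact: (christoffel_norm r_inj d_gt0 m_gt0 Bt BR).
Qed.
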